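(* For all integers $t\geq 4$ and $n\geq t+2$, there exist two distinct maximal $K_{1,t+1}$-matroids on $K_n$.
   Context: A $K_{1,t+1}$-matroid on $K_n$ is a matroid on $E(K_n)$ in which the edge set of every copy of $K_{1,t+1}$ in $K_n$ is a circuit. Maximality is with respect to the weak order on matroids on $E(K_n)$: $M\preceq N$ if every independent set of $M$ is independent in $N$; a $K_{1,t+1}$-matroid is maximal if it is a maximal element of the poset of all $K_{1,t+1}$-matroids on $K_n$. *)

(* Defs.v *)
From HB Require Import structures.
From mathcomp Require Import all_boot.

Set Implicit Arguments.
Unset Strict Implicit.
Unset Printing Implicit Defensive.

Definition matroid_axiom (T : finType) (I : {set {set T}}) : bool :=
  [&& set0 \in I,
      [forall A : {set T}, forall B : {set T},
         (B \in I) && (A \subset B) ==> (A \in I)]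
    & [forall A : {set T}, forall B : {set T},
         [&& A \in I, B \in I & #|A| < #|B|] ==>
           [exists x in B :\: A, x |: A \in I]]].

(* Matroids with ground set the whole finite type T, given by their family of
   independent sets. As matroid_axiom is boolean, two matroids are equal
   exactly when they have the same independent sets. *)
Record matroid (T : finType) : Type := Matroid {
  indep : {set {set T}};
  _ : matroid_axiom indep
}.

HB.instance Definition _ (T : finType) := [isSub for @indep T].
HB.instance Definition _ (T : finType) := [Finite of matroid T by <:].

Definition circuit (T : finType) (M : matroid T) (C : {set T}) : bool :=
  minset (fun A : {set T} => A \notin indep M) C.

Definition weak_le (T : finType) (M N : matroid T) : Prop :=
  forall A : {set T}, A \in indep M -> A \in indep N.

(* E(K_n), with vertex set 'I_n: the unordered pairs of distinct vertices. *)
Definition edge (n : nat) : finType := {e : {set 'I_n} | #|e| == 2}.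

Definition star (n : nat) (v : 'I_n) (S : {set 'I_n}) : {set edge n} :=
  [set e : edge n | [exists w in S, val e == [set v; w]]].

(* The copies of K_{1,k} in K_n are given by a centre v and a set S of k leaves
   avoiding v. *)
Definition star_matroid (k n : nat) (M : matroid (edge n)) : Prop :=
  forall (v : 'I_n) (S : {set 'I_n}),
    v \notin S -> #|S| = k -> circuit M (star v S).

Definition maximal_star_matroid (k n : nat) (M : matroid (edge n)) : Prop :=
  star_matroid k M /\
  forall N : matroid (edge n), star_matroid k N -> weak_le M N -> N = M.

(* Main.v *)
Require Import Defs.
From mathcomp Require Import all_boot all_algebra.
From mathcomp Require Import zify.

(* Every star matroid lies below a maximal one, so it is enough to find two star
   matroids M and N without a common star matroid P above both.

   M is the linear matroid in which the edge uv is represented by x_u /\ x_v,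
   where the points x_u lie on the moment curve in dimension t + 1: stars with
   t + 1 leaves are circuits since x_v /\ - has rank t, and the edge set of every
   K_{t+1} is independent. In N, a set A is independent when |A| <= 3t - 3, every
   star meets A in at most t edges and every union of two stars meets A in at most
   2t - 1 edges; for t >= 4 it contains K_{3,t-1} as an independent set.

   In a star matroid P on K_{t+2}, k stars have rank at most t + (t-1) + ... , with
   k terms. If K_{3,t-1}, with sides S and T, is independent in P, submodularity
   applied to the edges meeting S and those meeting T bounds the rank of P by
   (3t - 3) + (C(t+1,2) - 1) - (3t - 3) < C(t+1,2), so that no K_{t+1} is
   independent in P. *)

Set Implicit Arguments.
Unset Strict Implicit.
Unset Printing Implicit Defensive.

Import GRing.Theory Num.Theory.

(** * Rank function of a finite matroid *)

Section Rank.
Variables (T : finType) (M : matroid T).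
Implicit Types A B X Y : {set T}.

Lemma indep0 : set0 \in indep M.
Proof. by case: M => I /= /and3P[]. Qed.

Lemma indepS A B : B \in indep M -> A \subset B -> A \in indep M.
Proof.
case: M => I /= /and3P[_ /forallP H _] iB sAB.
by move/forallP/(_ B)/implyP: (H A); apply; rewrite iB.
Qed.

Lemma indep_aug A B : A \in indep M -> B \in indep M -> #|A| < #|B| ->
  exists2 x, x \in B :\: A & x |: A \in indep M.
Proof.
case: M => I /= /and3P[_ _ /forallP H] iA iB ltAB.
move/forallP/(_ B)/implyP: (H A); rewrite iA iB ltAB => /(_ isT).
by case/existsP=> x /andP[]; exists x.
Qed.

Definition rank X := \max_(A in indep M | A \subset X) #|A|.

Lemma leq_rank A X : A \in indep M -> A \subset X -> #|A| <= rank X.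
Proof. by move=> iA sAX; rewrite /rank (bigD1 A) ?iA //= leq_maxl. Qed.

Lemma rank_leqP X m :
  reflect (forall A, A \in indep M -> A \subset X -> #|A| <= m) (rank X <= m).
Proof.
rewrite /rank; apply: (iffP (bigmax_leqP _ _ _)) => H A.
  by move=> iA sAX; apply: H; rewrite iA.
by case/andP; apply: H.
Qed.

Lemma rank_leq_card X : rank X <= #|X|.
Proof. by apply/rank_leqP => A _; apply: subset_leq_card. Qed.

Lemma rankS X Y : X \subset Y -> rank X <= rank Y.
Proof.
move=> sXY; apply/rank_leqP => A iA sAX.
by apply: leq_rank => //; apply: subset_trans sXY.
Qed.

Lemma rank_indep A : A \in indep M -> rank A = #|A|.
Proof. by move=> iA; apply/eqP; rewrite eqn_leq rank_leq_card leq_rank. Qed.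

(** A maximal independent set between [A] and [X] has full rank: a larger independent subset of [X]
    would augment it. *)
Lemma indep_extend A X : A \in indep M -> A \subset X ->
  exists B, [/\ B \in indep M, A \subset B, B \subset X & #|B| = rank X].
Proof.
move=> iA sAX; pose P := [pred B | (B \in indep M) && (B \subset X)].
have [|B /maxsetP[/andP[iB sBX] maxB] sAB] := @maxset_exists _ P A.
  by rewrite /= iA.
exists B; split=> //; apply/eqP; rewrite eqn_leq leq_rank //=.
apply/rank_leqP => D iD sDX; rewrite leqNgt; apply/negP => ltBD.
have [x /setDP[xD xB] ixB] := indep_aug iB iD ltBD; case/negP: xB.
suff <-: x |: B = B by apply: setU11.
by apply: maxB; rewrite ?subsetUr //= ixB subUset sBX sub1set (subsetP sDX).
Qed.

(** Extend a basis [I] of [X :&: Y] to a basis [B] of [X :|: Y]. The traces of [B] on [X] and [Y]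
    are independent, cover [B], and both contain [I]. *)
Lemma rank_submod X Y : rank (X :|: Y) + rank (X :&: Y) <= rank X + rank Y.
Proof.
have [I [iI _ sI <-]] := indep_extend indep0 (sub0set (X :&: Y)).
have sIXY : I \subset X :|: Y.
  by apply: subset_trans sI _; rewrite subIset // subsetUl.
have [B [iB sIB sB <-]] := indep_extend iI sIXY.
have iBX Z : B :&: Z \in indep M by apply: indepS iB _; apply: subsetIl.
have leB Z : #|B :&: Z| <= rank Z by apply: leq_rank; rewrite // subsetIr.
apply: leq_trans (leq_add (leB X) (leB Y)).
rewrite -[leqRHS]cardsUI -setIUr -setIIr (setIidPl sB) leq_add2l.
by rewrite subset_leq_card // subsetI sIB.
Qed.

End Rank.

(** * Cliques, stars and bicliques in the complete graph *)

Section Edges.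
Variable n : nat.
Implicit Types (e : edge n) (u v w : 'I_n) (S Q U : {set 'I_n}).

Definition edges_in U : {set edge n} := [set e : edge n | val e \subset U].

(** The union of the full stars centred in [S]. For disjoint [S] and [Q], two such unions intersect
    in the biclique between [S] and [Q]. *)
Definition edges_meeting S : {set edge n} := [set e : edge n | ~~ [disjoint val e & S]].

Lemma edge_pair e : exists u v, u != v /\ val e = [set u; v].
Proof. exact/cards2P/(valP e). Qed.

Lemma edge_eq e u v : u \in val e -> v \in val e -> u != v -> val e = [set u; v].
Proof.
move=> ue ve uv; apply/esym/eqP.
by rewrite eqEcard subUset !sub1set ue ve cards2 uv (eqP (valP e)).
Qed.

Lemma pair_edge u v : u != v -> exists e : edge n, val e = [set u; v].
Proof.
move=> uv; have c2 : #|[set u; v]| == 2 by rewrite cards2 uv.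
by exists (exist (fun e : {set 'I_n} => #|e| == 2) _ c2).
Qed.

Lemma edges_meetingP e S :
  reflect (exists2 v, v \in val e & v \in S) (e \in edges_meeting S).
Proof.
rewrite inE -setI_eq0; apply: (iffP (set0Pn _)) => [[v /setIP[]]|[v ve vS]].
  by exists v.
by exists v; rewrite inE ve.
Qed.

Lemma edges_meeting0 : edges_meeting set0 = set0.
Proof.
by apply/setP => e; rewrite [RHS]inE; apply/edges_meetingP => -[v _]; rewrite inE.
Qed.

Lemma edges_meetingU S Q :
  edges_meeting (S :|: Q) = edges_meeting S :|: edges_meeting Q.
Proof.
apply/setP => e; rewrite [RHS]inE.
apply/edges_meetingP/orP => [[v ve /setUP[vS|vQ]]|].
- by left; apply/edges_meetingP; exists v.
- by right; apply/edges_meetingP; exists v.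
- by case=> /edges_meetingP[v ve vS]; exists v; rewrite // inE vS ?orbT.
Qed.

Lemma mem_star v S e : v \notin S ->
  (e \in star v S) = (v \in val e) && (val e \subset v |: S).
Proof.
move=> vS; rewrite inE; apply/existsP/andP => [[w /andP[wS /eqP->]]|].
  by rewrite setU11 setUS ?sub1set.
have [x [y [xy ->]]] := edge_pair e.
have aux w z : v \in [set w; z] -> w != z -> w = v ->
    [set w; z] \subset v |: S -> [set v; z] == [set v; z] /\ z \in S.
  move=> _ wz wv; rewrite subUset !sub1set => /andP[_].
  by rewrite !inE -wv eq_sym (negPf wz).
case=> vxy sxy; have := vxy; rewrite !inE => /orP[]/eqP Ev.
  by have [E zS] := aux _ _ vxy xy (esym Ev) sxy; exists y; rewrite zS Ev /= -Ev.
rewrite setUC in vxy sxy *; rewrite eq_sym in xy.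
by have [E zS] := aux _ _ vxy xy (esym Ev) sxy; exists x; rewrite zS Ev /= -Ev.
Qed.

Lemma card_edges_in U : #|edges_in U| = 'C(#|U|, 2).
Proof.
rewrite -(card_imset _ (@val_inj _ _ (edge n))) -cards_draws.
apply: eq_card => A; apply/imsetP/idP => [[e]|].
  by rewrite !inE => sU ->; rewrite sU (valP e).
rewrite inE => /andP[sAU /cards2P[x [y [xy EA]]]].
by have [e Ee] := pair_edge xy; exists e; rewrite ?inE Ee -?EA.
Qed.

Lemma card_star v S : v \notin S -> #|star v S| = #|S|.
Proof.
move=> vS; rewrite -(card_imset _ (@val_inj _ _ (edge n))).
have inj : {in S &, injective (fun w => [set v; w])}.
  move=> x y xS yS /setP/(_ x); rewrite !inE eqxx orbT => /esym/orP[]/eqP //.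
  by move=> xv; rewrite -xv xS in vS.
rewrite -(card_in_imset inj); apply: eq_card => A.
apply/imsetP/imsetP => [[e]|[w wS ->]].
  by rewrite inE => /existsP[w /andP[wS /eqP Ee]] ->; exists w.
have [|e Ee] := @pair_edge v w; first by apply: contraNneq vS => ->.
by exists e; rewrite ?Ee // inE; apply/existsP; exists w; rewrite wS Ee /=.
Qed.

Lemma starS v S Q : S \subset Q -> star v S \subset star v Q.
Proof.
move=> sSQ; apply/subsetP => e; rewrite !inE => /existsP[w /andP[wS Ee]].
by apply/existsP; exists w; rewrite (subsetP sSQ).
Qed.

(** An edge counted here has no end in [S :&: Q], so it joins [S :\: Q] to [Q :\: S]. *)
Lemma card_cross S Q :
  #|(edges_meeting S :&: edges_meeting Q) :\: edges_meeting (S :&: Q)|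
    <= #|S :\: Q| * #|Q :\: S|.
Proof.
rewrite -(card_imset _ (@val_inj _ _ (edge n))) -cardsX.
apply: leq_trans (leq_imset_card (fun p => [set p.1; p.2]) _).
apply: subset_leq_card; apply/subsetP => _ /imsetP[e /setDP[/setIP[eS eQ] eSQ] ->].
have [x xe xS] := edges_meetingP _ _ eS; have [y ye yQ] := edges_meetingP _ _ eQ.
have nSQ z : z \in val e -> ~~ ((z \in S) && (z \in Q)).
  by move=> ze; apply: contra eSQ => zSQ; apply/edges_meetingP; exists z; rewrite ?inE.
have xQ := nSQ x xe; have yS := nSQ y ye; rewrite xS /= in xQ.
rewrite yQ andbT in yS.
apply/imsetP; exists (x, y); first by rewrite !inE xS xQ yS yQ.
have xy : x != y by apply: contraNneq xQ => ->.
exact: edge_eq.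
Qed.

Lemma card_biclique S Q : [disjoint S & Q] ->
  #|edges_meeting S :&: edges_meeting Q| = #|S| * #|Q|.
Proof.
move=> dSQ; apply/eqP; rewrite eqn_leq; apply/andP; split.
  apply: leq_trans (leq_trans (card_cross S Q) _); last first.
    by rewrite leq_mul // subset_leq_card // subsetDl.
  by rewrite (disjoint_setI0 dSQ) edges_meeting0 setD0.
have neq x y : x \in S -> y \in Q -> x != y.
  move=> xS yQ; apply: contraTneq dSQ => Exy.
  by apply/pred0Pn; exists x; rewrite /= xS Exy yQ.
have inj : {in setX S Q &, injective (fun p => [set p.1; p.2])}.
  move=> [x y] [x' y'] /setXP[/= xS yQ] /setXP[/= xS' yQ'] /setP E.
  move: (E x) (E y); rewrite !inE !eqxx orbT /= => /esym + /esym.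
  rewrite (negPf (neq _ _ xS yQ')) orbF [y == x']eq_sym (negPf (neq _ _ xS' yQ)).
  by move=> /eqP-> /eqP->.
rewrite -cardsX -(card_in_imset inj) -(card_imset (edges_meeting _ :&: _) (@val_inj _ _ (edge n))).
apply/subset_leq_card/subsetP => _ /imsetP[[x y] /setXP[/= xS yQ] ->].
have [e Ee] := pair_edge (neq _ _ xS yQ).
apply/imsetP; exists e; rewrite ?Ee // inE.
apply/andP; split; apply/edges_meetingP; rewrite Ee.
  by exists x; rewrite // !inE eqxx.
by exists y; rewrite // !inE eqxx orbT.
Qed.

End Edges.

(** * Rank bounds valid in every star matroid *)

Section StarMatroid.
Variables (t n : nat) (M : matroid (edge n)).
Hypothesis starM : star_matroid t.+1 M.
Implicit Types S U : {set 'I_n}.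

Lemma star_indep v S U : v \notin U -> #|U| = t.+1 -> S \proper U ->
  star v S \in indep M.
Proof.
move=> vU cU ltSU; have sSU := proper_sub ltSU.
have vS : v \notin S by apply: contra vU; apply: subsetP.
have /minsetP[_ minU] := starM vU cU; apply: contraT => dep.
have := proper_card ltSU; rewrite -(card_star vU) -(card_star vS).
by rewrite (minU _ dep) ?ltnn ?starS.
Qed.

Lemma rank_star v U : v \notin U -> #|U| = t.+1 -> rank M (star v U) <= t.
Proof.
move=> vU cU; have /minsetP[dep _] := starM vU cU.
apply/rank_leqP => A iA sA; rewrite -ltnS -cU -(card_star vU).
rewrite ltn_neqAle subset_leq_card // andbT.
by apply: contra dep => /eqP/(subset_cardP)/(_ sA)/setP <-.
Qed.

(* Stars added one at a time contribute t, t - 1, t - 2, ... to the rank. *)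
Lemma rank_edges_meeting U S : #|U| = t.+2 -> S \subset U -> #|S| <= t.+1 ->
  rank M (edges_in U :&: edges_meeting S) + 'C(t.+1 - #|S|, 2) <= 'C(t.+1, 2).
Proof.
move=> cU; have [k] := ubnP #|S|; elim: k S => // k IH S /ltnSE ltSk sSU leSt.
have [->|/set0Pn[v vS]] := eqVneq S set0.
  rewrite cards0 subn0 edges_meeting0 setI0.
  by rewrite (leq_add2r _ _ 0) (leq_trans (rank_leq_card _ _)) ?cards0.
have cS := cardsD1 v S; rewrite vS add1n in cS.
set S' := S :\ v in cS; have vS' : v \notin S' by rewrite !inE eqxx.
have sS'U : S' \subset U :\ v by rewrite setSD.
have vU : v \in U := subsetP sSU v vS.
have vUv : v \notin U :\ v by rewrite !inE eqxx.
have cUv : #|U :\ v| = t.+1 by have := cardsD1 v U; rewrite vU cU => -[].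
have /IH : #|S'| < k by rewrite -cS.
rewrite (subset_trans sS'U (subsetDl _ _)) => /(_ isT) {}IH.
have {}IH := IH (leq_trans (leq_trans (leqnSn _) (eq_leq (esym cS))) leSt).
set X := edges_in U :&: edges_meeting S' in IH.
have -> : edges_in U :&: edges_meeting S = X :|: star v (U :\ v).
  apply/setP => e; rewrite -(setD1K vS) edges_meetingU setIUr !in_setU orbC.
  congr (_ || _); rewrite mem_star // setD1K // !in_setI [e \in edges_in _]inE andbC.
  by congr (_ && _); apply/edges_meetingP/idP => [[w we /set1P<-]|] //; exists v; rewrite ?inE.
(* The new star overlaps the earlier ones in at least [star v S'], which is independent, so it adds
   at most [t - #|S'|] to the rank. *)
have sub : star v S' \subset X :&: star v (U :\ v).
  rewrite subsetI starS // andbT subsetI; apply/andP; split; apply/subsetP => e.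
    rewrite mem_star // inE => /andP[_ /subset_trans]; apply.
    by rewrite subUset sub1set vU (subset_trans sS'U (subsetDl _ _)).
  rewrite !inE => /existsP[w /andP[wS /eqP->]]; apply/pred0Pn; exists w.
  by rewrite /= set22 wS.
have ltS' : S' \proper U :\ v by rewrite properEcard sS'U cUv; lia.
have := rankS M sub; rewrite (rank_indep (star_indep vUv cUv ltS')) card_star //.
have := rank_submod M X (star v (U :\ v)); have := rank_star vUv cUv.
(* By Pascal's rule the binomial on the left drops by exactly [t - #|S'|] when [v] is added. *)
have: t.+1 - #|S'| = (t.+1 - #|S|).+1 by lia.
move: IH => /[swap] ->; rewrite binS bin1; lia.
Qed.

Lemma clique_biclique_indepF U S (Q : {set 'I_n}) : 2 < t -> #|U| = t.+2 ->
  Q \subset U -> #|Q| = t.+1 -> S \subset U -> #|S| = 3 ->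
  edges_in Q \in indep M ->
  edges_meeting S :&: edges_meeting (U :\: S) \in indep M -> False.
Proof.
move=> lt2t cU sQU cQ sSU cS iQ iK.
have cT : #|U :\: S| = t.-1 by rewrite cardsD (setIidPr sSU) cU cS; lia.
have dST : [disjoint S & U :\: S] by rewrite -setI_eq0 setIDA setIC setDIl setDv setI0.
have cK := card_biclique dST; rewrite cS cT in cK.
have := rank_edges_meeting cU sSU; have := rank_edges_meeting cU (subsetDl U S).
(* The two bounds leave the remainders ['C(t - 2, 2)] and ['C(2, 2) = 1]; the latter is the whole
   margin of the contradiction. *)
have -> : t.+1 - #|S| = (t - 2) by lia.
have -> : t.+1 - #|U :\: S| = 2 by lia.
set X := edges_in U :&: edges_meeting S; set Y := edges_in U :&: edges_meeting _.
move=> /(_ ltac:(lia)) rY /(_ ltac:(lia)) rX.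
have := rank_submod M X Y.
have : edges_meeting S :&: edges_meeting (U :\: S) \subset X :&: Y.
  rewrite -setIIr subsetI subxx andbT; apply/subsetP => e /setIP[].
  move=> /edges_meetingP[x xe xS] /edges_meetingP[y ye /setDP[yU yS]].
  have xy : x != y by apply: contraNneq yS => <-.
  by rewrite inE (edge_eq xe ye xy) subUset !sub1set yU (subsetP sSU).
move/(rankS M); rewrite rank_indep // cK.
have : edges_in Q \subset X :|: Y.
  rewrite -setIUr -edges_meetingU setDE setUIr setUCr setIT.
  rewrite subsetI; apply/andP; split; apply/subsetP => e; rewrite inE => sQ.
    by rewrite inE (subset_trans sQ).
  have [x [y [_ Ee]]] := edge_pair e; apply/edges_meetingP.
  have xe : x \in val e by rewrite Ee set21.
  by exists x; rewrite // inE (subsetP sQU) ?orbT // (subsetP sQ).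
move/(rankS M); rewrite rank_indep // card_edges_in cQ.
(* Pascal's rule now leaves ['C(t - 2, 2)] as the only nonlinear term. *)
move: rX rY; have -> : t.+1 = (t - 2).+3 by lia.
by rewrite !binS !bin0 !bin1; lia.
Qed.

End StarMatroid.

(** * The matroid defined by counting edges on stars *)

Section CountMatroid.
Variables (t n : nat).
Hypothesis lt2t : 2 < t.
Implicit Types (A B : {set edge n}) (S Q : {set 'I_n}).

(** The sum [t + (t - 1) + ...] with [q] terms, as in the rank bound for [q] stars: [cap 1 = t],
    [cap 2 = 2t - 1], [cap 3 = 3t - 3]. *)
Definition cap q := t * q - 'C(q, 2).

(** Bundled as one rewriting rule; two sets of at most 2 vertices have a union of at most 4. *)
Lemma bin2_small : (('C(0, 2) = 0) * ('C(1, 2) = 0) * ('C(2, 2) = 1) *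
  ('C(3, 2) = 3) * ('C(4, 2) = 6))%type.
Proof. by []. Qed.

Definition count_family : {set {set edge n}} :=
  [set A : {set edge n} | (#|A| <= cap 3) &&
     [forall Q : {set 'I_n},
        (#|Q| <= 2) ==> (#|A :&: edges_meeting Q| <= cap #|Q|)]].

Lemma count_familyP A :
  reflect (#|A| <= cap 3 /\
           forall Q, #|Q| <= 2 -> #|A :&: edges_meeting Q| <= cap #|Q|)
          (A \in count_family).
Proof.
rewrite inE; apply: (iffP andP) => -[leA H]; split=> //.
  by move=> Q; apply/implyP; apply: (forallP H).
by apply/forallP => Q; apply/implyP; apply: H.
Qed.

(* cap is modular up to the |S \ Q| * |Q \ S| edges joining S \ Q to Q \ S. *)
Lemma tightU A S Q : A \in count_family -> #|S| <= 2 -> #|Q| <= 2 ->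
  cap #|S| <= #|A :&: edges_meeting S| -> cap #|Q| <= #|A :&: edges_meeting Q| ->
  cap #|S :|: Q| <= #|A :&: edges_meeting (S :|: Q)|.
Proof.
move=> /count_familyP[_ boundA] leS leQ tS tQ.
have bI : #|S :&: Q| <= 2 by apply: leq_trans leS; rewrite subset_leq_card ?subsetIl.
have {boundA}bI' := boundA _ bI.
have := cardsUI (A :&: edges_meeting S) (A :&: edges_meeting Q).
rewrite -setIUr -edges_meetingU -setIIr.
set X := edges_meeting S :&: edges_meeting Q.
have := subset_leq_card (subsetIr A (X :\: edges_meeting (S :&: Q))).
have leX : #|A :&: X| <= #|A :&: edges_meeting (S :&: Q)|
                    + #|A :&: (X :\: edges_meeting (S :&: Q))|.
  apply: leq_trans (leq_of_leqif (leq_card_setU _ _)); rewrite -setIUr.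
  apply/subset_leq_card/setIS/subsetP => e eX.
  by rewrite in_setU in_setD eX andbT orbN.
have leC := card_cross S Q.
have cS := cardsID Q S; have cQ := cardsID S Q; have cU := cardsUI S Q.
rewrite setIC in cQ; move: #|_ :\: edges_meeting _| leC => d leC leD eU.
move: leS leQ tS tQ bI bI' eU leX; rewrite /cap.
have -> : #|S :|: Q| = #|S :&: Q| + #|S :\: Q| + #|Q :\: S| by lia.
rewrite -cS -cQ; move: leC leD; move: #|S :\: Q| #|Q :\: S| #|S :&: Q| => a b i.
(* Each of the three blocks has at most 2 vertices, so finitely many cases remain, all linear in
   [t]. *)
by case: i => [|[|[|i]]]; case: a => [|[|[|a]]]; case: b => [|[|[|b]]] //=;
  rewrite ?(addSn, add0n, addnS, addn0) !bin2_small; lia.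
Qed.

(** For augmentation, suppose no edge of [B :\: A] can be added while [#|A| < cap 3]. Each such edge
    is blocked by a tight set that it meets, and all tight sets lie in a largest one, [S]. So [B] is
    inside [A] away from the stars of [S], and on these stars [A] already attains the bound that [B]
    obeys. *)
Lemma count_family_matroid : matroid_axiom count_family.
Proof.
apply/and3P; split.
- by apply/count_familyP; split=> [|Q _]; rewrite ?set0I cards0.
- apply/forallP => A; apply/forallP => B; apply/implyP => /andP[].
  move=> /count_familyP[leB H] sAB; apply/count_familyP; split.
    exact: leq_trans (subset_leq_card sAB) leB.
  by move=> Q /H; apply: leq_trans; rewrite subset_leq_card ?setSI.
apply/forallP => A; apply/forallP => B; apply/implyP => /and3P[iA iB ltAB].
apply: contraLR ltAB => /existsPn/= noaug; rewrite -leqNgt.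
have [leA boundA] := count_familyP _ iA; have [leB boundB] := count_familyP _ iB.
have [geA|ltA] := leqP (cap 3) #|A|; first exact: leq_trans geA.
pose tight := [pred Q : {set 'I_n} | (#|Q| <= 2) && (cap #|Q| <= #|A :&: edges_meeting Q|)].
have [|S /maxsetP[/andP[leS tS] maxS] _] := @maxset_exists _ tight set0.
  by rewrite /= cards0 /cap muln0.
have subS Q : tight Q -> Q \subset S.
  case/andP=> leQ tQ; have tU := tightU iA leS leQ tS tQ.
  (* A union of size 3 or 4 would force [#|A|] up to [cap 3], since [cap 4 = 4t - 6] is at least
     [cap 3] for [t >= 3]. *)
  have [le2|lt2] := leqP #|S :|: Q| 2.
    by rewrite -(maxS (S :|: Q)) ?subsetUl ?subsetUr //= le2.
  suff: cap 3 <= #|A| by rewrite leqNgt ltA.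
  apply: leq_trans (leq_trans tU _); last by rewrite subset_leq_card ?subsetIl.
  have := leq_trans (leq_of_leqif (leq_card_setU S Q)) (leq_add leS leQ); move: #|S :|: Q| lt2 => u.
  rewrite /cap; case: u => [|[|[|[|[|u]]]]] // _ _;
    rewrite ?(addSn, add0n, addnS, addn0) !bin2_small; lia.
have sBA : B :\: A \subset edges_meeting S.
  apply/subsetP => e eBA; have := noaug e; rewrite eBA /= inE negb_and.
  have [eB eA] := setDP eBA; rewrite cardsU1 eA add1n ltA /=.
  case/forallPn => Q; rewrite negb_imply -ltnNge => /andP[leQ].
  have [eQ|eQ] := boolP (e \in edges_meeting Q).
    rewrite setIUl (setIidPl _) ?sub1set // cardsU1 inE (negPf eA) ltnS => ltQ.
    have /subS sQS : tight Q by rewrite /= leQ.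
    by have [v ve vQ] := edges_meetingP _ _ eQ; apply/edges_meetingP; exists v;
      rewrite ?(subsetP sQS).
  rewrite setIUl (_ : [set e] :&: _ = set0) ?set0U ?ltnNge ?boundA //.
  by apply/setP => x; rewrite !inE; case: eqP => // ->; apply: negbTE; rewrite inE in eQ.
rewrite -(cardsID (edges_meeting S) A) -(cardsID (edges_meeting S) B).
apply: leq_add; first exact: leq_trans (boundB _ leS) tS.
rewrite subset_leq_card //; apply/subsetP => e /setDP[eB eS].
by rewrite !in_setD eS; apply: contraR eS => eA; apply: (subsetP sBA); rewrite inE eA.
Qed.

Definition count_matroid := Matroid count_family_matroid.

(** The star exceeds [cap 1 = t] at its centre, while a proper subset has at most [t] edges, and [t]
    is at most [cap 1], [cap 2] and [cap 3]. *)
Lemma count_star_matroid : star_matroid t.+1 count_matroid.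
Proof.
move=> v S vS cS; have cvS := card_star vS; apply/minsetP; split=> [|B dB sB].
  apply/count_familyP => -[_ /(_ [set v])]; rewrite cards1 /cap => /(_ isT).
  rewrite (setIidPl _) ?cvS ?cS ?bin_small ?muln1 ?subn0 ?ltnn //.
  apply/subsetP => e; rewrite mem_star // => /andP[ve _].
  by apply/edges_meetingP; exists v; rewrite ?set11.
apply/eqP; rewrite eqEcard sB cvS cS ltnNge; apply: contra dB => leB.
apply/count_familyP; split; first by rewrite (leq_trans leB) // /cap bin2_small; lia.
move=> Q; have [->|nQ] := eqVneq Q set0; first by rewrite edges_meeting0 setI0 !cards0.
rewrite -cards_eq0 in nQ; move=> leQ.
apply: leq_trans (leq_trans (subset_leq_card (subsetIl _ _)) leB) _.
by rewrite /cap; move: #|Q| nQ leQ => [|[|[|q]]] //= _ _; rewrite bin2_small; lia.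
Qed.

(** The size is exactly [cap 3]. Degrees are at most [t - 1], where [t >= 4] is needed for the
    vertices of [T], of degree 3; so two stars take at most [2t - 2] edges. *)
Lemma biclique_count_indep S (T : {set 'I_n}) : 3 < t ->
  [disjoint S & T] -> #|S| = 3 -> #|T| = t.-1 ->
  edges_meeting S :&: edges_meeting T \in indep count_matroid.
Proof.
move=> lt3t dST cS cT; set K := _ :&: _; apply/count_familyP; split.
  by rewrite card_biclique // cS cT /cap bin2_small; lia.
have deg v : #|K :&: edges_meeting [set v]| <= t.-1.
  have aux (P R : {set 'I_n}) : #|R| <= t.-1 -> v \notin R ->
      #|edges_meeting P :&: edges_meeting R :&: edges_meeting [set v]| <= t.-1.
    move=> leR vR; apply: leq_trans (leR); rewrite -[leqRHS]mul1n -(cards1 v).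
    rewrite -card_biclique ?disjoints1 //; apply: subset_leq_card.
    by rewrite setIC setIS // subsetIr.
  have [vT|vT] := boolP (v \in T); last by apply: aux; rewrite ?cT.
  rewrite /K (setIC (edges_meeting S)); apply: aux; first by rewrite cS; lia.
  by apply: contraTN vT => vS; rewrite (disjointFr dST vS).
move=> Q; have [->|nQ] := eqVneq Q set0; first by rewrite edges_meeting0 setI0 !cards0.
rewrite -cards_eq0 in nQ; rewrite leq_eqVlt ltnS => /orP[/cards2P[x [y [xy ->]]]|leQ].
  rewrite cards2 xy edges_meetingU setIUr /cap bin2_small.
  have := leq_of_leqif (leq_card_setU (K :&: edges_meeting [set x]) (K :&: edges_meeting [set y])).
  by move/leq_trans; apply; have := leq_add (deg x) (deg y); move/leq_trans; apply; lia.
have /cards1P[v ->] : #|Q| == 1 by rewrite eqn_leq leQ lt0n.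
by rewrite cards1 /cap bin2_small; apply: leq_trans (deg v) _; lia.
Qed.

End CountMatroid.

(** * Matroids represented by vectors *)

Section LinearMatroid.
Variables (F : fieldType) (V : vectType F) (T : finType) (f : T -> V).
Local Open Scope ring_scope.

(** Freeness is asked of a sequence, so that two elements with equal vectors are dependent. *)
Definition linear_family : {set {set T}} :=
  [set A : {set T} | free [seq f e | e <- enum A]].

(** If no element of [B] augments [A], the span of [B] lies in that of [A], and dimensions compare
    the cardinals. *)
Lemma linear_family_matroid : matroid_axiom linear_family.
Proof.
have memf (A : {set T}) e : e \in A -> f e \in <<[seq f e | e <- enum A]>>%VS.
  by move=> eA; apply/memv_span/map_f; rewrite mem_enum.
apply/and3P; split.
- by rewrite inE enum_set0 nil_free.
- apply/forallP => A; apply/forallP => B; apply/implyP; rewrite !inE.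
  case/andP=> fB sAB; have pB : perm_eq (enum B) (enum A ++ enum (B :\: A)).
    apply: uniq_perm; rewrite ?cat_uniq ?enum_uniq ?andbT //=.
      by apply/hasPn => e; rewrite !mem_enum => /setDP[].
    move=> e; rewrite mem_cat !mem_enum in_setD.
    by have [/(subsetP sAB)->|] := boolP (e \in A).
  rewrite (perm_free (perm_map f pB)) map_cat in fB.
  exact: catl_free fB.
apply/forallP => A; apply/forallP => B; apply/implyP; rewrite !inE => /and3P[fA fB].
apply: contraLR => /existsPn noaug; rewrite -leqNgt.
have dimf (D : {set T}) : free [seq f e | e <- enum D] ->
    \dim <<[seq f e | e <- enum D]>> = #|D|.
  by rewrite cardE -(size_map f) => /eqP.
rewrite -(dimf _ fA) -(dimf _ fB); apply/dimvS/span_subvP => _ /mapP[e eB ->].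
rewrite mem_enum in eB; have [|eA] := boolP (e \in A); first exact: memf.
have := noaug e; rewrite inE eA eB inE /= => /negP dep; apply/negPn/negP => fe.
apply: dep; have pA : perm_eq (enum (e |: A)) (e :: enum A).
  apply: uniq_perm; rewrite ?enum_uniq //= ?mem_enum ?eA ?enum_uniq //.
  by move=> x; rewrite inE !mem_enum in_setU1.
by rewrite (perm_free (perm_map f pA)) /= free_cons fe.
Qed.

Definition linear_matroid := Matroid linear_family_matroid.

(** A dual system certifies freeness: [phi e] kills every combination of the other vectors but not
    [f e]. *)
Lemma linear_indep_dual (W : lmodType F) (phi : T -> {linear V -> W}) (A : {set T}) :
  {in A &, forall e e', (phi e (f e') == 0) = (e != e')} ->
  A \in indep linear_matroid.
Proof.
move=> dual; rewrite inE; have: {subset enum A <= A} by move=> e; rewrite mem_enum.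
elim: (enum A) (enum_uniq A) => [|e s IH] /=; first by rewrite nil_free.
case/andP=> es us sA; have eA : e \in A by apply: sA; rewrite mem_head.
have {}sA x : x \in s -> x \in A by move=> xs; apply: sA; rewrite inE xs orbT.
rewrite free_cons IH // andbT; apply/negP => fes.
have := dual e e eA eA; rewrite eqxx (coord_span (X := in_tuple _) fes) linear_sum.
rewrite big1 ?eqxx // => i _; rewrite linearZ /=.
have lti : (i < size s)%N by rewrite -(size_map f).
rewrite (nth_map e) //; apply/eqP; rewrite scaler_eq0; apply/orP; right.
by rewrite dual ?eA ?sA ?mem_nth //; apply: contraNneq es => ->; rewrite mem_nth.
Qed.

End LinearMatroid.

(** * Bivectors of points on the moment curve *)

Section WedgeMatroid.
Variables t n : nat.
Local Open Scope ring_scope.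
Implicit Types (u v w : 'I_n) (e : edge n) (U : {set 'I_n}).

Definition node u : rat := u%:R.

Lemma node_inj : injective node.
Proof. by move=> u v /eqP; rewrite eqr_nat => /eqP/val_inj. Qed.

Definition moment u : 'rV[rat]_t.+1 := \row_k node u ^+ k.

(** The bivector of [p] and [q], encoded as an antisymmetric matrix. *)
Definition wedge (p q : 'rV[rat]_t.+1) : 'M[rat]_t.+1 := p^T *m q - q^T *m p.

(* A multiple of x_u /\ x_v: the scalar is antisymmetric as well, so that no
   orientation of the edge has to be chosen. *)
Definition edge_vector e : 'M[rat]_t.+1 :=
  \sum_(u in val e) \sum_(v in val e)
    (node u - node v) *: ((moment u)^T *m moment v).

Lemma edge_vectorE e u v : u != v -> val e = [set u; v] ->
  edge_vector e = (node u - node v) *: wedge (moment u) (moment v).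
Proof.
move=> uv Ee; rewrite /edge_vector Ee.
have nuv : u \notin [set v] by rewrite inE.
rewrite big_setU1 //= big_set1 !(big_setU1 _ nuv) /= !big_set1 !subrr !scale0r.
by rewrite add0r addr0 -[node v - _]opprB scaleNr -scalerBr.
Qed.

Definition wedge_matroid := linear_matroid edge_vector.

(** The unnormalised Lagrange polynomial of [w] for the nodes of [U]. *)
Definition node_poly U w : {poly rat} := \prod_(u in U :\ w) ('X - (node u)%:P).

Lemma size_node_poly U w : w \in U -> size (node_poly U w) = #|U|.
Proof.
move=> wU; rewrite /node_poly -big_enum size_prod_XsubC -cardE.
by rewrite [RHS](cardsD1 w) wU.
Qed.

Lemma node_poly_eq0 U w u : u \in U -> ((node_poly U w).[node u] == 0) = (u != w).
Proof.
move=> uU; rewrite horner_prod; apply/idP/idP.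
  apply: contraTneq => ->; apply/prodf_neq0 => v /setD1P[vw _].
  by rewrite hornerXsubC subr_eq0 (inj_eq node_inj) eq_sym.
by move=> uw; rewrite (bigD1 u) ?in_setD1 ?uw //= hornerXsubC subrr mul0r.
Qed.

Definition coef_col (p : {poly rat}) : 'cV[rat]_t.+1 := \col_k p`_k.

Lemma moment_coef u (p : {poly rat}) : (size p <= t.+1)%N ->
  moment u *m coef_col p = (p.[node u])%:M.
Proof.
move=> szp; rewrite [LHS]mx11_scalar mxE (horner_coef_wide _ szp).
by congr _%:M; apply: eq_bigr => k _; rewrite !mxE mulrC.
Qed.

Lemma scalar_mx1_eq0 (a : rat) : (a%:M == 0 :> 'M_1) = (a == 0).
Proof.
apply/eqP/eqP => [/matrixP/(_ 0 0)|->]; last by rewrite raddf0.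
by rewrite !mxE.
Qed.

(** Coefficient columns act on moment vectors by evaluation, so pairing a bivector with two of them
    gives a 2 by 2 determinant of values. *)
Lemma wedge_eval (w z : {poly rat}) u v : (size w <= t.+1)%N -> (size z <= t.+1)%N ->
  (coef_col w)^T *m wedge (moment u) (moment v) *m coef_col z =
  (w.[node u] * z.[node v] - w.[node v] * z.[node u])%:M.
Proof.
move=> szw szz; rewrite /wedge mulmxBr mulmxBl !mulmxA -!trmx_mul.
rewrite -!(mulmxA (_^T)) !moment_coef // !tr_scalar_mx -!scalar_mxM.
by rewrite -raddfB.
Qed.

(** Pairing with the Lagrange polynomials of the two ends of each edge gives a dual system; their
    degree [#|U| - 1] fits the dimension. *)
Lemma wedge_indep U : (#|U| <= t.+1)%N -> edges_in U \in indep wedge_matroid.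
Proof.
move=> leU; pose is_ends e (p : 'I_n * 'I_n) := (p.1 != p.2) && (val e == [set p.1; p.2]).
have ends e : {p | is_ends e p}.
  apply: sigW; have [u [v [uv Ee]]] := edge_pair e.
  by exists (u, v); rewrite /is_ends /= uv Ee eqxx.
pose phi e : {linear _ -> _} :=
  mulmxr (coef_col (node_poly U (sval (ends e)).2)) \o
  mulmx (coef_col (node_poly U (sval (ends e)).1))^T.
apply: (@linear_indep_dual _ _ _ _ _ phi) => e e'; rewrite !inE /phi /=.
case: (ends e) => -[w z] /= /andP[/= wz /eqP Ee].
have [u [v [uv Ee']]] := edge_pair e'; rewrite (edge_vectorE uv Ee').
rewrite Ee Ee' !subUset !sub1set => /andP[wU zU] /andP[uU vU].
have szU x : x \in U -> (size (node_poly U x) <= t.+1)%N by move/size_node_poly->.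
rewrite -scalemxAr -scalemxAl wedge_eval ?szU // scaler_eq0 subr_eq0.
rewrite (inj_eq node_inj) (negPf uv) scalar_mx1_eq0 subr_eq0 /=.
have -> : (e == e') = ((u == w) && (v == z) || (u == z) && (v == w)).
  rewrite (_ : (e == e') = ([set w; z] == [set u; v])); last by rewrite -Ee -Ee'.
  apply/eqP/orP.
    move=> E; have /set2P wuv : w \in [set u; v] by rewrite -E set21.
    have /set2P zuv : z \in [set u; v] by rewrite -E set22.
    by case: wuv zuv wz => -> [] ->; rewrite !eqxx; auto.
  by case=> /andP[/eqP-> /eqP->] //; rewrite setUC.
(* In either case one of the two products of the determinant vanishes, and the other decides. *)
have [uw|uw] := eqVneq u w.
  have vw : v != w by rewrite -uw eq_sym.
  have /eqP-> : (node_poly U w).[node v] == 0 by rewrite node_poly_eq0.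
  by rewrite mul0r mulf_eq0 !node_poly_eq0 // uw eqxx (negPf wz) orbF.
have /eqP-> : (node_poly U w).[node u] == 0 by rewrite node_poly_eq0.
by rewrite mul0r eq_sym mulf_eq0 !node_poly_eq0 // negb_and orbC.
Qed.

Lemma wedge_sumr p (a : 'I_t.+1 -> rat) (q : 'I_t.+1 -> 'rV_t.+1) :
  wedge p (\sum_k a k *: q k) = \sum_k a k *: wedge p (q k).
Proof.
rewrite /wedge mulmx_sumr linear_sum /= mulmx_suml -sumrB.
by apply: eq_bigr => k _; rewrite -scalemxAr [(_ *: _)^T]linearZ /= -scalemxAl scalerBr.
Qed.

(** The [t + 1] vectors of a star lie in a space spanned by [t] bivectors. Without one of its edges,
    the star sits in a clique on [t + 1] vertices, which is independent. *)
Lemma wedge_star_matroid : star_matroid t.+1 wedge_matroid.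
Proof.
move=> v S vS cS; apply/minsetP; split=> [|B dB sB].
  rewrite inE; apply/negP => /eqP; rewrite size_map -cardE card_star // cS => dim.
  pose X := [seq wedge (moment v) (delta_mx 0 (lift ord0 k)) | k : 'I_t].
  have := dim_span X; rewrite size_map -cardE card_ord => leX.
  suff /leq_trans/(_ leX) : (t.+1 <= \dim <<X>>)%N by rewrite ltnn.
  apply: leq_trans (eq_leq (esym dim)) _; apply: dimvS; apply/span_subvP => _ /mapP[e + ->].
  rewrite mem_enum inE => /existsP[w /andP[wS /eqP Ee]].
  have vw : v != w by apply: contraNneq vS => ->.
  rewrite (edge_vectorE vw Ee); apply: memvZ.
  have -> : wedge (moment v) (moment w) = wedge (moment v) (moment w - moment v).
    by rewrite /wedge [(_ - _)^T]linearB /= mulmxBr mulmxBl opprB addrA subrK.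
  (* Moment vectors have first coordinate 1, so their difference uses only the other [t] basis
     vectors. *)
  rewrite (row_sum_delta (_ - _)) wedge_sumr big_ord_recl !mxE !expr0 subrr scale0r add0r.
  apply: memv_suml => k _; apply/memvZ/memv_span/map_f.
  by rewrite mem_enum.
apply/eqP; rewrite eqEsubset sB; apply: contraR dB => /subsetPn[e eS eB].
move: (eS); rewrite inE => /existsP[w /andP[wS /eqP Ee]].
have sBw : B \subset edges_in (v |: S :\ w).
  apply/subsetP => e' e'B; have := subsetP sB e' e'B.
  rewrite !inE => /existsP[w' /andP[w'S /eqP Ee']].
  rewrite Ee' setUS // sub1set in_setD1 w'S andbT.
  by apply: contraNneq eB => Ew; rewrite (_ : e = e') //; apply: val_inj; rewrite Ee Ee' Ew.
apply: indepS sBw; apply: wedge_indep.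
by rewrite cardsU1 in_setD1 (negPf vS) andbF add1n ltnS -ltnS -cS (cardsD1 w S) wS.
Qed.

End WedgeMatroid.

(** * Maximal star matroids and the conclusion *)

Lemma maximal_star_above k n (M : matroid (edge n)) : star_matroid k M ->
  exists N, maximal_star_matroid k N /\ weak_le M N.
Proof.
move=> starM.
pose starb (N : matroid (edge n)) := [forall v : 'I_n, forall S : {set 'I_n},
  (v \notin S) ==> (#|S| == k) ==> circuit N (star v S)].
have starbP N : reflect (star_matroid k N) (starb N).
  apply: (iffP forallP) => [H v S vS /eqP cS|H v].
    by have /implyP/(_ vS)/implyP/(_ cS) := forallP (H v) S.
  by apply/forallP => S; apply/implyP => vS; apply/implyP => /eqP; apply: H.
pose above (N : matroid (edge n)) := starb N && (indep M \subset indep N).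
have aboveM : above M by rewrite /above subxx andbT; apply/starbP.
(* There are finitely many matroids; one with the most independent sets among the star matroids
   above [M] is maximal. *)
case: (arg_maxnP (fun N => #|indep N|) aboveM) => N /andP[/starbP starN leMN] maxN.
exists N; split; last exact/subsetP.
split=> // P starP /subsetP leNP; apply/val_inj/esym/eqP.
rewrite eqEcard leNP; apply: maxN; rewrite /above (subset_trans leMN leNP) andbT.
exact/starbP.
Qed.

Lemma card_ord_lt n k : k <= n -> #|[set i : 'I_n | i < k]| = k.
Proof. by move=> le; rewrite -sum1dep_card -(big_ord_widen _ (fun=> 1)) // sum1_card card_ord. Qed.

Theorem theorem2p12 (t n : nat) (ht : 4 <= t) (hn : t + 2 <= n) :
  exists M N : matroid (edge n),
    [/\ M <> N, maximal_star_matroid t.+1 M & maximal_star_matroid t.+1 N].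
Proof.
have lt2t : 2 < t := ltnW ht.
have [M [maxM leM]] := maximal_star_above (@wedge_star_matroid t n).
have [N [maxN leN]] := maximal_star_above (@count_star_matroid t n lt2t).
exists M, N; split=> // EMN.
pose I k := [set i : 'I_n | i < k].
have IS k l : k <= l -> I k \subset I l.
  by move=> kl; apply/subsetP => i; rewrite !inE => /leq_trans; apply.
have cI k : k <= t.+2 -> #|I k| = k.
  by move=> le; apply/card_ord_lt/(leq_trans le); rewrite -addn2.
have sSU : I 3 \subset I t.+2 by apply: IS; lia.
have cS : #|I 3| = 3 by rewrite cI; lia.
(* All takes place on the first [t + 2] vertices: the clique is independent through the wedge
   matroid, the biclique through the counting one. *)
apply: (@clique_biclique_indepF _ _ M (proj1 maxM) (I t.+2) (I 3) (I t.+1)) => //;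
  rewrite ?cI ?IS //.
  by apply: leM; apply: wedge_indep; rewrite cI.
rewrite EMN; apply: leN; apply: biclique_count_indep => //.
  by rewrite disjoint_sym disjoints_subset setDE subsetIr.
by rewrite cardsD (setIidPr sSU) cS cI // subSS subSS subn1.
Qed.
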